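(* For every transposition sequence $\langle s_1,\ldots,s_m\rangle$ over $\mathbf{S}_n$, its dual is $$\left\langle s_1,\; s_2^{\,s_1},\; s_3^{\,s_2 s_1},\;\ldots,\; s_m^{\,s_{m-1}\cdots s_1}\right\rangle .$$
   Context: $\mathbf{S}_n$ is the symmetric group on $[n]=\{1,\ldots,n\}$; permutations are multiplied from left to right (in $p\cdot q$, $p$ is applied first). A transposition sequence over $\mathbf{S}_n$ is a finite sequence of transpositions of $\mathbf{S}_n$. For permutations $p,t$, $p^{t}$ denotes the conjugate $t^{-1}pt$. Dual (Mind-Body Dual): A Mind-Body Assignment over $n$ is a permutation $A\in\mathbf{S}_n$, thought of as mapping each mind $M$ to the body $A(M)$; one says $M$ is above $A(M)$. For a transposition $(x,y)$, the body-swapping operation turns $A$ into the assignment in which the bodies $x$ and $y$ are exchanged (the mind that was above $x$ is now above $y$ and vice versa; all else unchanged). Given $\mathbf{s}=\langle s_1,\ldots,s_m\rangle$, let $A_0$ be the identity and let $A_k$ be the result of applying to $A_{k-1}$ the body-swapping operation with $s_k$. The dual of $\mathbf{s}$ is $\langle s_1',\ldots,s_m'\rangle$, where, if $s_k=(x,y)$, then $s_k'=(x',y')$ with $x'$ above $x$ and $y'$ above $y$ in $A_{k-1}$. *)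

(* Defs.v *)
From mathcomp Require Import all_boot all_fingroup.
Set Implicit Arguments.
Unset Strict Implicit.
Unset Printing Implicit Defensive.

Local Open Scope group_scope.

(* [n] = {1, ..., n} is modelled by 'I_n = {0, ..., n-1}.  In {perm 'I_n},
   (p * q) x = q (p x), so products are read from left to right, and
   p ^ t = t^-1 * (p * t). *)

Definition is_transposition (n : nat) (t : 'S_n) : Prop :=
  exists x y : 'I_n, x != y /\ t = tperm x y.

Definition transposition_seq (n : nat) (s : seq 'S_n) : Prop :=
  forall t : 'S_n, t \in s -> is_transposition t.

(* An assignment A : 'S_n maps each mind M to the body A M. *)
Definition above (n : nat) (A : 'S_n) (M b : 'I_n) : Prop := A M = b.

Definition body_swap_fun (n : nat) (A : 'S_n) (x y M : 'I_n) : 'I_n :=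
  if A M == x then y else if A M == y then x else A M.

Lemma body_swap_inj (n : nat) (A : 'S_n) (x y : 'I_n) :
  injective (body_swap_fun A x y).
Proof.
move=> M1 M2; rewrite /body_swap_fun => eqM; apply: (@perm_inj _ A).
move: eqM; do 4?case: eqP; congruence.
Qed.

Definition body_swap (n : nat) (A : 'S_n) (x y : 'I_n) : 'S_n :=
  perm (@body_swap_inj n A x y).

(* A k is the assignment after the first k swaps; sequences are 0-indexed, so
   the k-th entry of s acts on A k.  The transposition s_k = (x, y) does not
   order its endpoints, so any choice of x and y is admitted; the dual is
   therefore given as a relation between s and s'. *)
Definition is_dual (n : nat) (s s' : seq 'S_n) : Prop :=
  size s' = size s /\
  exists A : nat -> 'S_n,
    A 0 = 1 /\
    forall k : nat, k < size s ->
      exists x y x' y' : 'I_n,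
        [/\ x != y /\ nth 1 s k = tperm x y,
            A k.+1 = body_swap (A k) x y,
            above (A k) x' x,
            above (A k) y' y
          & nth 1 s' k = tperm x' y'].

(* Main.v *)
Require Import Defs.
From mathcomp Require Import all_boot all_fingroup.

Local Open Scope group_scope.

(* Swapping the bodies of s_k turns A into A * s_k, so A_{k-1} is the product
   s_1 ... s_{k-1}, whose inverse is s_{k-1} ... s_1 because transpositions are
   involutions.  The minds above x and y are the preimages of x and y under
   A_{k-1}, hence s_k' is the conjugate of s_k by the inverse of A_{k-1}. *)

Lemma body_swapE (n : nat) (A : 'S_n) (x y : 'I_n) :
  body_swap A x y = A * tperm x y.
Proof.
apply/permP => M; rewrite permE permM /body_swap_fun.
(* The last [eqP] serves [A M = y]: the test against [x] comes first, and [x = y] is not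
   excluded. *)
by case: tpermP => [->|->|/eqP/negPf-> /eqP/negPf->] //; rewrite eqxx //;
  case: eqP.
Qed.

Lemma prod_rev_transpositions (n : nat) (s : seq 'S_n) :
  transposition_seq s -> \prod_(t <- rev s) t = (\prod_(t <- s) t)^-1.
Proof.
elim: s => [|t s IHs] hs; first by rewrite !big_nil invg1.
have [x [y [_ t_xy]]] : is_transposition t by apply: hs; rewrite mem_head.
rewrite rev_cons -cats1 big_cat big_seq1 big_cons invMg IHs.
  by rewrite t_xy tpermV.
by move=> u us; apply: hs; rewrite inE us orbT.
Qed.

Lemma prod_takeS (n : nat) (s : seq 'S_n) (k : nat) : k < size s ->
  \prod_(t <- take k.+1 s) t = (\prod_(t <- take k s) t) * nth 1 s k.
Proof.
by move=> lt_ks; rewrite (take_nth 1 lt_ks) -cats1 big_cat big_seq1.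
Qed.

Theorem theorem5p5 (n : nat) (s : seq 'S_n) (hs : transposition_seq s)
    (s' : seq 'S_n) :
  is_dual s s' <->
  s' = mkseq (fun k : nat => nth 1 s k ^ (\prod_(t <- rev (take k s)) t))
             (size s).
Proof.
pose P k := \prod_(t <- take k s) t.
have revP k : \prod_(t <- rev (take k s)) t = (P k)^-1.
  by apply: prod_rev_transpositions => t /mem_take; apply: hs.
split=> [[szs' [A [A0 dualA]]] | ->].
  (* The order chosen for the endpoints of each swap does not affect [A]. *)
  have AP k : k <= size s -> A k = P k.
    elim: k => [_|k IHk lt_ks]; first by rewrite A0 /P take0 big_nil.
    have [x [y [_ [_ [[_ sk] -> _ _ _]]]]] := dualA k lt_ks.
    by rewrite body_swapE IHk 1?ltnW // /P prod_takeS // sk.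
  apply: (@eq_from_nth _ 1); rewrite ?size_mkseq // => k; rewrite szs' => lt_ks.
  have [x [y [x' [y' [[_ sk] _ Ax' Ay' ->]]]]] := dualA k lt_ks.
  (* Conjugation acts on the endpoints: the inverse of [A k] sends [x], [y] back to [x'], [y']. *)
  by rewrite nth_mkseq // revP -AP 1?ltnW // sk tpermJ -Ax' -Ay' !permK.
split; first by rewrite size_mkseq.
(* Conversely, the prefix products serve as assignments. *)
exists P; split=> [|k lt_ks]; first by rewrite /P take0 big_nil.
have [x [y [x_neq_y sk]]] := hs _ (mem_nth 1 lt_ks).
exists x, y, ((P k)^-1 x), ((P k)^-1 y); rewrite /above !permKV; split=> //.
  by rewrite body_swapE /P prod_takeS // sk.
by rewrite nth_mkseq // revP sk tpermJ.
Qed.
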